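(* Let $\Delta\in \mathbb{N}$ and let $\lambda^\star>0$. Let $\mathcal{G}$ be a family of graphs of maximum degree at most $\Delta$. If the hard-core model on $\mathcal{G}$ satisfies very strong spatial mixing (VSSM) at $\lambda^\star$, then there exists $\varepsilon>0$ such that for each $G=(V,E)\in \mathcal{G}$ and each $\vec\lambda=(\lambda_v)_{v\in V}\in B(\lambda^\star,\varepsilon)^V$ we have $Z_G(\vec \lambda)\neq 0$.
   Context: All graphs are finite and simple; $\mathbb N=\{1,2,\dots\}$. $B(\lambda^\star,\varepsilon)$ is the open disc in $\mathbb C$ with centre $\lambda^\star$ and radius $\varepsilon$. For a graph $G=(V,E)$, $\mathcal I_G$ is the collection of independent sets of $G$, and for $\vec\lambda=(\lambda_v)_{v\in V}$ the multivariate independence polynomial is $Z_G(\vec\lambda)=\sum_{I\in\mathcal I_G}\prod_{v\in I}\lambda_v$. For $v\in V$ and $\ell\in\mathbb N$, $S_G(v,\ell)$ is the set of vertices at distance exactly $\ell$ from $v$ in $G$. Boundary conditions and ratios: a boundary condition on $G$ is a map $\sigma:V_\sigma\to\{0,1\}$ with $V_\sigma\subset V$ such that $V_{\sigma,\mathrm{in}}:=\sigma^{-1}(1)$ is independent in $G$. For $v\in V\setminus V_\sigma$ put $$Z^{v\,\mathrm{in}}_{(G,\sigma)}(\lambda)=\sum_{\substack{v\in I\subseteq V\setminus V_\sigma\\ I\cup V_{\sigma,\mathrm{in}}\in\mathcal I_G}}\lambda^{|I|},\qquad Z^{v\,\mathrm{out}}_{(G,\sigma)}(\lambda)=\sum_{\substack{v\notin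 I\subseteq V\setminus V_\sigma\\ I\cup V_{\sigma,\mathrm{in}}\in\mathcal I_G}}\lambda^{|I|},\qquad R_{(G,\sigma),v}(\lambda)=\frac{Z^{v\,\mathrm{in}}_{(G,\sigma)}(\lambda)}{Z^{v\,\mathrm{out}}_{(G,\sigma)}(\lambda)}.$$ Tree of self avoiding walks: fix a total ordering of the vertices of $G$ (inherited by induced subgraphs). For a vertex $v$ of $G$ the rooted tree $T_{\mathrm{SAW}(G,v)}$ (with root $v$) is defined recursively. If the component of $G$ containing $v$ is $\{v\}$, then $T_{\mathrm{SAW}(G,v)}$ is the single vertex $v$. Otherwise let $v_1,\dots,v_d$ be the neighbours of $v$ in $G$ (listed in increasing order), let $G_i$ be obtained from $G$ by removing $v,v_1,\dots,v_{i-1}$, and let $T_i=T_{\mathrm{SAW}(G_i,v_i)}$; then $T_{\mathrm{SAW}(G,v)}$ is obtained from the disjoint union of $T_1,\dots,T_d$ by adding a root vertex $v$ joined to the root $v_i$ of each $T_i$. VSSM: the hard-core model on a family $\mathcal G$ of bounded degree graphs satisfies VSSM at $\lambda>0$ if there exist constants $\alpha\in[0,1)$ and $C>0$ such that for all $G\in\mathcal G$, every induced subgraph $H$ of $G$, every $v\in V(H)$, every $\ell\in\mathbb N$ and all boundary conditions $\sigma,\tau:S_{T}(v,\ell)\to\{0,1\}$ with $T=T_{\mathrm{SAW}(H,v)}$, we have $|R_{(T,\sigma),v}(\lambda)-R_{(T,\tau),v}(\lambda)|\le C\alpha^\ell$. *)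

(* Defs.v *)
From HB Require Import structures.
From mathcomp Require Import all_boot all_order all_algebra.
From mathcomp Require Import complex.
From mathcomp Require Import reals.

Set Implicit Arguments.
Unset Strict Implicit.
Unset Printing Implicit Defensive.

Import Order.TTheory GRing.Theory Num.Theory.
Local Open Scope ring_scope.

Record sgraph := SGraph {
  vertex :> finType;
  adj : rel vertex;
  adj_sym : symmetric adj;
  adj_irr : irreflexive adj }.

Definition neighbours (G : sgraph) (v : G) : {set G} := [set w | adj v w].

Definition max_degree (G : sgraph) : nat := (\max_(v : G) #|neighbours v|)%N.

Definition independent (G : sgraph) (I : {set G}) : bool :=
  [forall x in I, forall y in I, ~~ adj x y].

Definition walk (G : sgraph) (n : nat) (x y : G) : bool :=
  [exists p : n.-tuple G, path (@adj G) x p && (last x p == y)].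

Definition dist_is (G : sgraph) (x y : G) (n : nat) : bool :=
  walk n x y && [forall k : 'I_n, ~~ walk k x y].

Definition sphere (G : sgraph) (v : G) (l : nat) : {set G} :=
  [set w | dist_is v w l].

Definition indep_poly (G : sgraph) (K : comNzRingType) (lam : G -> K) : K :=
  \sum_(I : {set G} | independent I) \prod_(v in I) lam v.

(* A map from a subset of the vertices to {0,1} is a partial boolean function:
   [None] marks the vertices outside its domain. *)
Section BoundaryCondition.
Variables (G : sgraph) (s : {ffun G -> option bool}).

Definition bc_dom : {set G} := [set x | s x != None].
Definition bc_in : {set G} := [set x | s x == Some true].

Definition boundary_condition : bool := independent bc_in.

Variable K : fieldType.

Definition Z_in (v : G) (lam : K) : K :=
  \sum_(I : {set G} | [&& v \in I, I \subset ~: bc_dom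
                        & independent (I :|: bc_in)]) lam ^+ #|I|.

Definition Z_out (v : G) (lam : K) : K :=
  \sum_(I : {set G} | [&& v \notin I, I \subset ~: bc_dom
                        & independent (I :|: bc_in)]) lam ^+ #|I|.

(* Only meaningful for [v \notin bc_dom].  At a positive real [lam] the
   denominator is positive, because of the term [I = set0]. *)
Definition ratio (v : G) (lam : K) : K := Z_in v lam / Z_out v lam.

End BoundaryCondition.

Record rgraph := RGraph { rgraph_graph :> sgraph; root : rgraph_graph }.

Definition point : rgraph :=
  @RGraph (@SGraph unit (fun _ _ => false) (fun _ _ => erefl) (fun _ => erefl))
    tt.

Section Attach.
Variables T B : rgraph.

Definition attach_adj : rel (T + B)%type := fun x y =>
  match x, y with
  | inl a, inl b => adj a b
  | inr a, inr b => adj a b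
  | inl a, inr b => (a == root T) && (b == root B)
  | inr b, inl a => (a == root T) && (b == root B)
  end.

Lemma attach_adj_sym : symmetric attach_adj.
Proof. by move=> [x|x] [y|y] //=; rewrite adj_sym. Qed.

Lemma attach_adj_irr : irreflexive attach_adj.
Proof. by move=> [x|x] /=; rewrite adj_irr. Qed.

(* Disjoint union of [T] and [B] with an edge between the roots, rooted at
   the root of [T]. *)
Definition attach : rgraph :=
  @RGraph (SGraph attach_adj_sym attach_adj_irr) (inl (root T)).

End Attach.

(* A new root joined to the roots of disjoint copies of the members of [ts]. *)
Definition join_root (ts : seq rgraph) : rgraph :=
  foldr (fun B T => attach T B) point ts.

Definition total_order (T : Type) (r : rel T) : Prop :=
  [/\ antisymmetric r, transitive r & total r].

(* The induced subgraph on a vertex set [A] of [G] is represented by [A]. *)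
Section SawTree.
Variables (G : sgraph) (le : rel G).

(* For [ws = v_1, ..., v_d], the trees [t (A \ {v_1, ..., v_{i-1}}) v_i]. *)
Fixpoint branches (t : {set G} -> G -> rgraph) (A : {set G}) (ws : seq G) :
    seq rgraph :=
  if ws is w :: ws' then t A w :: branches t (A :\ w) ws' else [::].

Definition sorted_neighbours (A : {set G}) (v : G) : seq G :=
  sort le (enum (neighbours v :&: A)).

Fixpoint saw_tree_rec (n : nat) (A : {set G}) (v : G) : rgraph :=
  if n is n'.+1 then
    join_root (branches (saw_tree_rec n') (A :\ v) (sorted_neighbours A v))
  else point.

(* The tree of self avoiding walks from [v] in the subgraph induced by [A];
   the recursion depth is bounded by #|A|, see [saw_treeE]. *)
Definition saw_tree (A : {set G}) (v : G) : rgraph := saw_tree_rec #|A| A v.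

Lemma eq_branches t1 t2 (A : {set G}) ws :
  uniq ws -> {subset ws <= A} ->
  (forall (B : {set G}) w, B \subset A -> w \in B -> t1 B w = t2 B w) ->
  branches t1 A ws = branches t2 A ws.
Proof.
elim: ws A => //= w ws IH A /andP[wws uws] sA t12.
have wA : w \in A by apply: sA; rewrite mem_head.
rewrite t12 //; congr cons; apply: IH => // [x xws|B x BA xB].
  rewrite in_setD1 sA ?inE ?xws ?orbT // andbT.
  by apply: contraNneq wws => <-.
by apply: t12 => //; apply: subset_trans BA (subsetDl _ _).
Qed.

Lemma sorted_neighbours_uniq A v : uniq (sorted_neighbours A v).
Proof. by rewrite sort_uniq enum_uniq. Qed.

Lemma sorted_neighbours_sub A v :
  {subset sorted_neighbours A v <= A :\ v}.
Proof.
move=> x; rewrite mem_sort mem_enum !inE => /andP[vx ->]; rewrite andbT.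
by apply: contraTneq vx => ->; rewrite adj_irr.
Qed.

Lemma saw_tree_rec_eq n m (A : {set G}) v : v \in A ->
  (#|A| <= n)%N -> (#|A| <= m)%N -> saw_tree_rec n A v = saw_tree_rec m A v.
Proof.
elim: n m A v => [|n IH] [|m] A v vA //=.
- by rewrite leqn0 cards_eq0 => /eqP A0; rewrite A0 inE in vA.
- by move=> _; rewrite leqn0 cards_eq0 => /eqP A0; rewrite A0 inE in vA.
rewrite (cardsD1 v) vA add1n !ltnS => An Am; congr join_root.
apply: eq_branches; [exact: sorted_neighbours_uniq|
  exact: sorted_neighbours_sub|].
by move=> B w /subset_leq_card BA wB; apply: IH => //; apply: leq_trans BA _.
Qed.

(* When [v] is isolated in the subgraph induced by [A] the list of branches is
   empty and the right-hand side is [point]. *)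
Lemma saw_treeE (A : {set G}) v : v \in A ->
  saw_tree A v = join_root (branches saw_tree (A :\ v) (sorted_neighbours A v)).
Proof.
move=> vA; rewrite {1}/saw_tree (cardsD1 v) vA add1n /=; congr join_root.
apply: eq_branches; [exact: sorted_neighbours_uniq|
  exact: sorted_neighbours_sub|].
move=> B w /subset_leq_card BA wB; exact: saw_tree_rec_eq.
Qed.

End SawTree.

(* [le G] is the total order fixed on the vertices of [G], on which the trees
   depend; induced subgraphs inherit it. *)
Definition VSSM (R : realType) (le : forall G : sgraph, rel G)
    (F : sgraph -> Prop) (lam : R) : Prop :=
  exists alpha C : R, [/\ 0 <= alpha, alpha < 1, 0 < C &
    forall (G : sgraph), F G ->
    forall (A : {set G}) (v : G), v \in A ->
    forall l : nat, (0 < l)%N ->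
    let T := saw_tree (le G) A v in
    forall s t : {ffun T -> option bool},
      boundary_condition s -> boundary_condition t ->
      bc_dom s = sphere (root T) l -> bc_dom t = sphere (root T) l ->
      `|ratio s (root T) lam - ratio t (root T) lam| <= C * alpha ^+ l].

Definition disc (R : realType) (c : R[i]) (eps : R) (z : R[i]) : Prop :=
  `|z - c| < (eps%:C)%C.

(* Main.v *)
From HB Require Import structures.
From mathcomp Require Import all_boot all_order all_algebra.
From mathcomp Require Import complex.
From mathcomp Require Import reals.
From mathcomp Require Import ring lra.
Require Import Defs.

Set Implicit Arguments.
Unset Strict Implicit.
Unset Printing Implicit Defensive.

Import Order.TTheory GRing.Theory Num.Theory.
Local Open Scope ring_scope.

(** ** Why very strong spatial mixing excludes zeros

For a vertex [v] of an induced subgraph [A] put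
[rho (A, v) = lam v * Z (A - N[v]) / Z (A - v)], so that
[Z A = (1 + rho (A, v)) * Z (A - v)]: it suffices to keep all these ratios
away from [-1]. Deleting the neighbours of [v] one after another gives
[rho x = lam v * prod_c 1 / (1 + rho c)], where [c] runs over the pairs
(remaining vertex set, neighbour) that are the children of the root in the
tree of self avoiding walks ([vertex_ratio_rec]). At the real point [lstar] all
ratios [r x] are positive; let [p x = r x / (1 + r x)]. To first order the
relative errors [e x = rho x / r x - 1] of a complex perturbation satisfy
[e x = - sum_c p c * e c], so after [l] levels they are multiplied by at most
the [l]-step influence, the sum over the descendants at depth [l] of the product
of the [p]'s along the path. If for some [l] it is at most [1/4] everywhere, a
bound on the errors by a small enough constant is inherited from the descendants
by the root, whatever the size of the graph ([relative_error_contraction]), and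
induction on the number of vertices concludes ([induced_poly_neq0]).

So mixing has to be turned into decay of influence ([influence_decay]). This is
not immediate, because the number of descendants grows exponentially in [l],
possibly faster than the mixing rate decays. The point is that a
self-avoiding-walk tree is bipartite and the recursion is decreasing in every
child, so that the all-in and all-out boundary conditions at a given depth push
the ratio at the root to its two extremes, and the contributions of all boundary
vertices add up instead of cancelling. If [lo <= r <= hi] are these extremes,
then Weierstrass's inequality [1 + sum t <= prod (1 + t)] bounds [hi / lo - 1]
at a vertex below by [sum_c lo c / (1 + lo c) * (hi c / lo c - 1)]
([gap_step]). By mixing, applied at every vertex of the tree (a subtree is again
a self-avoiding-walk tree of an induced subgraph), [lo c] is exponentially close
to [r c], so the coefficients are at least [beta * p c], with [beta < 1] as
close to 1 as wanted except for boundedly many levels near the boundary. Up to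
constant factors, the gap for a boundary at depth [k] thus dominates [beta ^ k]
times the influence, while mixing bounds it by [alpha ^ k]: any [beta] strictly
between [alpha] and 1 will do.

The link to the boundary-condition ratios on trees is made through partition
functions with arbitrary in- and out-weights at each vertex, which factorize
when two trees are joined at their roots ([two_state_attach],
[sphere_ratio_saw_tree]). *)

(** * Elementary inequalities *)

Section Estimates.
Variable R : realFieldType.

Lemma bernoulli (n : nat) (x : R) : 0 <= x -> x <= 1 ->
  1 - n%:R * x <= (1 - x) ^+ n.
Proof.
move=> x0 x1; elim: n => [|n IH]; first by rewrite expr0; lra.
rewrite exprS -natr1.
have [h|h] := ltP (1 - n%:R * x) 0.
  have : 0 <= (1 - x) * (1 - x) ^+ n by rewrite mulr_ge0 ?exprn_ge0; lra.
  lra.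
have /(le_trans _) : (1 - x) * (1 - n%:R * x) <= (1 - x) * (1 - x) ^+ n.
  by apply: ler_wpM2l => //; lra.
apply; have : 0 <= n%:R * x * x by rewrite !mulr_ge0.
nra.
Qed.

Lemma weierstrass_prod (I : eqType) (s : seq I) (t : I -> R) :
  {in s, forall c, 0 <= t c} ->
  1 + \sum_(c <- s) t c <= \prod_(c <- s) (1 + t c).
Proof.
elim: s => [|a s IH] ht; first by rewrite !big_nil addr0.
rewrite !big_cons.
have ta : 0 <= t a by apply: ht; rewrite mem_head.
have hs : {in s, forall c, 0 <= t c} by move=> c cs; apply: ht; rewrite inE cs orbT.
have S0 : 0 <= \sum_(c <- s) t c by rewrite big_seq sumr_ge0.
have := IH hs; nra.
Qed.

(** The converse of the previous bound up to a factor that is close to 1 when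
    all factors are, which makes it a first-order estimate. *)
Lemma prod_sub1_le (I : eqType) (s : seq I) (t : I -> R) (M : R) (n : nat) :
  1 <= M -> (size s <= n)%N ->
  {in s, forall c, 0 <= t c /\ 1 + t c <= M} ->
  \prod_(c <- s) (1 + t c) - 1 <= M ^+ n * \sum_(c <- s) t c.
Proof.
move=> M1 sn ht.
have /le_trans : \prod_(c <- s) (1 + t c) - 1 <= M ^+ size s * \sum_(c <- s) t c.
  elim: s ht {sn} => [|a s IH] ht; first by rewrite !big_nil mulr0 subrr.
  rewrite !big_cons /=.
  have [ta tM] : 0 <= t a /\ 1 + t a <= M by apply: ht; rewrite mem_head.
  have hs : {in s, forall c, 0 <= t c /\ 1 + t c <= M}.
    by move=> c cs; apply: ht; rewrite inE cs orbT.
  have S0 : 0 <= \sum_(c <- s) t c.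
    by rewrite big_seq sumr_ge0 // => c /hs[].
  have Ms : 1 <= M ^+ size s by rewrite exprn_ege1.
  have := IH hs; set P := \prod_(c <- s) _; set S := \sum_(c <- s) _ => hP.
  rewrite exprS -mulrA.
  have h1 : (1 + t a) * (P - 1) <= M * (M ^+ size s * S).
    apply: le_trans (_ : (1 + t a) * (M ^+ size s * S) <= _).
      by apply: ler_wpM2l => //; lra.
    by apply: ler_wpM2r => //; rewrite mulr_ge0 //; lra.
  have h2 : t a <= M * (M ^+ size s * t a).
    rewrite mulrA ler_peMl // -[1]mulr1.
    by apply: ler_pM.
  by rewrite !mulrDr; nra.
apply; apply: ler_wpM2r; last exact: ler_weXn2l.
by rewrite big_seq sumr_ge0 // => c /ht[].
Qed.

End Estimates.

Lemma expr_eventually_le (R : realType) (q e : R) : 0 <= q -> q < 1 -> 0 < e ->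
  exists n0 : nat, forall n, (n0 <= n)%N -> q ^+ n <= e.
Proof.
move=> q0 q1 e0.
have key n : q ^+ n * (1 + n%:R * (1 - q)) <= 1.
  elim: n => [|n IH]; first by rewrite expr0; lra.
  apply: le_trans IH; rewrite exprSr -mulrA.
  apply: ler_wpM2l; first exact: exprn_ge0.
  rewrite -natr1; have : 0 <= n%:R :> R by [].
  by set k := n%:R => k0; have := sqr_ge0 (1 - q); rewrite expr2; nra.
have t0 : 0 < e * (1 - q) by rewrite mulr_gt0 // subr_gt0.
have b0 : 0 <= (e * (1 - q))^-1 by rewrite invr_ge0 ltW.
exists (Num.bound (e * (1 - q))^-1) => n hn.
have : (e * (1 - q))^-1 < n%:R.
  apply: lt_le_trans (archi_boundP b0) _; by rewrite ler_nat.
rewrite -div1r ltr_pdivrMr // => h.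
have qn := exprn_ge0 n q0.
rewrite leNgt; apply/negP => hlt.
have := key n; nra.
Qed.

(** * The tree recursion at a positive real parameter *)

Section Recursion.
(** The tree is presented by its set [X] of states and the list [ch x] of
    children of each state; [r] is a positive solution of the recursion. *)
Variables (R : realFieldType) (X : eqType) (ch : X -> seq X).
Variables (lam : R) (Delta : nat) (r : X -> R).
Hypothesis lam_gt0 : 0 < lam.
Hypothesis ch_size : forall x, (size (ch x) <= Delta)%N.
Hypothesis r_gt0 : forall x, 0 < r x.
Hypothesis r_rec : forall x, r x = lam * \prod_(c <- ch x) (1 + r c)^-1.

(** The extreme ratios at [x] when all the vertices at depth [k + 1] below [x] are
    fixed in the same way: [b = true] gives the maximum. A child that is itself
    fixed contributes the factor 1 if it is out and 0 if it is in, which is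
    [b%:R]; one level up the roles of the two extremes are exchanged, hence the
    negation. *)
Fixpoint extreme_ratio (k : nat) (b : bool) (x : X) : R :=
  lam * \prod_(c <- ch x)
    (if k is k'.+1 then (1 + extreme_ratio k' (~~ b) c)^-1 else b%:R).

(** The probability that the root is occupied. *)
Definition occupation (x : X) : R := r x / (1 + r x).

(** Up to the sign [(-1) ^ k], the sum over the descendants [c] at depth [k] of the
    logarithmic derivatives of [r x] with respect to [r c]. *)
Fixpoint influence (k : nat) (x : X) : R :=
  if k is k'.+1 then \sum_(c <- ch x) occupation c * influence k' c else 1.

Let rmin := lam / (1 + lam) ^+ Delta.

Lemma occupation_ge0 x : 0 <= occupation x.
Proof. by rewrite divr_ge0 ?addr_ge0 // ltW. Qed.

Lemma occupation_le1 x : occupation x <= 1.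
Proof. by rewrite ler_pdivrMr ?mul1r; have := r_gt0 x; lra. Qed.

Lemma influence_ge0 k x : 0 <= influence k x.
Proof.
elim: k x => //= k IH x; rewrite sumr_ge0 // => c _.
by rewrite mulr_ge0 ?occupation_ge0.
Qed.

Lemma sum_occupation_le x : \sum_(c <- ch x) occupation c <= Delta%:R.
Proof.
apply: le_trans (_ : (size (ch x))%:R <= _); last by rewrite ler_nat.
elim: (ch x) => [|a s IH]; first by rewrite big_nil.
by rewrite big_cons /= -nat1r lerD ?occupation_le1.
Qed.

Lemma prod_ler_seq (s : seq X) (f g : X -> R) :
  (forall c, 0 <= f c /\ f c <= g c) ->
  0 <= \prod_(c <- s) f c /\ \prod_(c <- s) f c <= \prod_(c <- s) g c.
Proof.
move=> fg; split; first by apply: prodr_ge0 => c _; case: (fg c).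
by apply: ler_prod => c _; apply/andP; exact: fg.
Qed.

Lemma extreme_ratio_sandwich k x :
  [/\ 0 <= extreme_ratio k false x, extreme_ratio k false x <= r x,
      r x <= extreme_ratio k true x & extreme_ratio k true x <= lam].
Proof.
have inv_le1 t : 0 <= t -> 0 <= (1 + t)^-1 /\ (1 + t)^-1 <= 1 :> R.
  by move=> t0; rewrite invr_ge0 invf_le1; lra.
elim: k x => [|k IH] x /=.
  have [p0 _] := prod_ler_seq (ch x) (f := fun=> 0) (g := fun=> 0)
    (fun=> conj (lexx _) (lexx _)).
  have [_ p1] := prod_ler_seq (ch x) (f := fun=> 0) (g := fun c => (1 + r c)^-1)
    (fun c => conj (lexx _) (proj1 (inv_le1 _ (ltW (r_gt0 c))))).
  have [_ p2] := prod_ler_seq (ch x) (f := fun c => (1 + r c)^-1) (g := fun=> 1)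
    (fun c => inv_le1 _ (ltW (r_gt0 c))).
  split.
  - by rewrite mulr_ge0 // ltW.
  - by rewrite r_rec; apply: ler_wpM2l => //; exact: ltW.
  - by rewrite r_rec; apply: ler_wpM2l => //; exact: ltW.
  - by rewrite big1 ?mulr1.
have anti s t : 0 <= s -> s <= t -> 0 <= (1 + t)^-1 /\ (1 + t)^-1 <= (1 + s)^-1 :> R.
  by move=> s0 st; rewrite invr_ge0 lef_pV2 ?posrE; lra.
have bt c : 0 <= extreme_ratio k true c.
  by have [_ _ h _] := IH c; apply: le_trans h; exact: ltW.
have bf c : 0 <= extreme_ratio k false c by case: (IH c).
have [p0 p1] := prod_ler_seq (ch x) (f := fun c => (1 + extreme_ratio k true c)^-1)
    (g := fun c => (1 + r c)^-1)
    (fun c => anti _ _ (ltW (r_gt0 c)) (let: And4 _ _ h _ := IH c in h)).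
have [_ p2] := prod_ler_seq (ch x) (f := fun c => (1 + r c)^-1)
    (g := fun c => (1 + extreme_ratio k false c)^-1)
    (fun c => anti _ _ (bf c) (let: And4 _ h _ _ := IH c in h)).
have [_ p3] := prod_ler_seq (ch x) (f := fun c => (1 + extreme_ratio k false c)^-1)
    (g := fun=> 1) (fun c => inv_le1 _ (bf c)).
split.
- by rewrite mulr_ge0 // ltW.
- by rewrite r_rec; apply: ler_wpM2l => //; exact: ltW.
- by rewrite r_rec; apply: ler_wpM2l => //; exact: ltW.
- rewrite -[leRHS]mulr1; apply: ler_wpM2l; first exact: ltW.
  by apply: le_trans p3 _; rewrite big1.
Qed.

Lemma extreme_ratio_ge0 k b x : 0 <= extreme_ratio k b x.
Proof.
have [? ? ? _] := extreme_ratio_sandwich k x; case: b => //.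
by apply: le_trans (ltW (r_gt0 x)) _.
Qed.

Lemma extreme_ratio_le_lam k b x : extreme_ratio k b x <= lam.
Proof.
have [h0 h1 h2 h3] := extreme_ratio_sandwich k x; case: b => //.
by apply: le_trans h1 (le_trans h2 h3).
Qed.

(** At most [Delta] factors, each at least [1 / (1 + lam)]: bounded degree keeps
    the ratios away from 0 uniformly. *)
Lemma rmin_le_prod (s : seq X) (f : X -> R) : (size s <= Delta)%N ->
  (forall c, 0 <= f c /\ f c <= lam) -> rmin <= lam * \prod_(c <- s) (1 + f c)^-1.
Proof.
move=> sD hf; apply: ler_wpM2l; first exact: ltW.
apply: le_trans (_ : ((1 + lam)^-1) ^+ size s <= _).
  rewrite exprVn lef_pV2 ?posrE ?exprn_gt0 ?addr_gt0 //.
  by apply: ler_weXn2l => //; have := lam_gt0; lra.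
elim: s {sD} => [|a s IH]; first by rewrite big_nil.
have l0 := lam_gt0; have [fa0 fa1] := hf a.
rewrite big_cons /= exprS; apply: ler_pM => //.
- by rewrite invr_ge0; lra.
- by rewrite exprn_ge0 // invr_ge0; lra.
- by rewrite lef_pV2 ?posrE; lra.
Qed.

Lemma rmin_gt0 : 0 < rmin.
Proof. by rewrite divr_gt0 ?exprn_gt0 ?addr_gt0. Qed.

Lemma rmin_le_r x : rmin <= r x.
Proof.
rewrite r_rec; apply: rmin_le_prod => // c; split; first exact: ltW.
have [_ _ h1 h2] := extreme_ratio_sandwich 0 c; exact: le_trans h1 h2.
Qed.

Lemma rmin_le_extreme_ratio k b x : rmin <= extreme_ratio k.+1 b x.
Proof.
apply: (@rmin_le_prod (ch x) (fun c => extreme_ratio k (~~ b) c)) => // c.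
by split; [exact: extreme_ratio_ge0 | exact: extreme_ratio_le_lam].
Qed.

(** The relative width is the right measure of the gap between the extremes: its
    recursion has the occupation probabilities as coefficients. *)
Definition gap k x : R := extreme_ratio k true x / extreme_ratio k false x - 1.

(** [hi / lo] at [x] is the product over the children of
    [(1 + hi) / (1 + lo) = 1 + (hi - lo) / (1 + lo)]. All the increments have the
    same sign, so the contributions of the children add up. *)
Lemma gap_step k x :
  \sum_(c <- ch x) (extreme_ratio k true c - extreme_ratio k false c)
                   / (1 + extreme_ratio k false c)
    <= gap k.+1 x.
Proof.
have lo1 c : 0 < 1 + extreme_ratio k false c by have := extreme_ratio_ge0 k false c; lra.
have hi1 c : 0 < 1 + extreme_ratio k true c by have := extreme_ratio_ge0 k true c; lra.
have -> : gap k.+1 x = \prod_(c <- ch x)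
    (1 + (extreme_ratio k true c - extreme_ratio k false c)
         / (1 + extreme_ratio k false c)) - 1.
  rewrite /gap /= invfM mulrACA divff ?gt_eqF // mul1r -prodfV -big_split /=.
  congr (_ - 1); apply: eq_bigr => c _; rewrite invrK.
  by rewrite mulrC; field; rewrite gt_eqF.
rewrite lerBrDl; apply: weierstrass_prod => c _.
have [_ h1 h2 _] := extreme_ratio_sandwich k c.
by rewrite divr_ge0 ?(ltW (lo1 c)) // subr_ge0 (le_trans h1).
Qed.

(** One level above the fixed vertices, a child with children of its own has
    extremes 0 and [lam], and a childless one contributes nothing to either
    side. At [k = 0] the lower extreme can vanish, so the comparison of gap and
    influence has to start at [k = 1]. *)
Lemma gap_base x : (0 < Delta)%N ->
  lam / Delta%:R * influence 2 x <= gap 1 x.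
Proof.
move=> D0; apply: le_trans (gap_step 0 x).
have l0 := lam_gt0; have d0 : 0 < Delta%:R :> R by rewrite ltr0n.
have infl2 : influence 2 x = \sum_(c <- ch x) occupation c * \sum_(d <- ch c) occupation d.
  by apply: eq_bigr => c _; congr (_ * _); apply: eq_bigr => d _; rewrite mulr1.
rewrite infl2 mulr_sumr; apply: ler_sum => c _.
have hT : extreme_ratio 0 true c = lam by rewrite /= big1 ?mulr1.
case E : (ch c) (sum_occupation_le c) => [|d s] hD.
  rewrite big_nil mulr0 mulr0; apply: divr_ge0.
    by rewrite subr_ge0 hT extreme_ratio_le_lam.
  by rewrite addr_ge0 ?extreme_ratio_ge0.
have -> : extreme_ratio 0 false c = 0 by rewrite /= E big_cons mul0r mulr0.
rewrite hT subr0 addr0 divr1.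
rewrite mulrAC ler_pdivrMr // ler_wpM2l //; first exact: ltW.
rewrite -[leRHS]mul1r; apply: ler_pM => //; first exact: occupation_ge0.
- by rewrite sumr_ge0 // => e _; exact: occupation_ge0.
- exact: occupation_le1.
Qed.

(** Since [(hi - lo) / (1 + lo)] is [lo / (1 + lo)] times the gap of the child,
    the gap dominates the influence at the next level too, with a loss [f] that
    measures how far the lower extremes fall below the true ratios. *)
Lemma gap_next k x K f : 0 <= K -> 0 <= f ->
  (forall c, f * r c <= extreme_ratio k.+1 false c) ->
  (forall c, K * influence k.+2 c <= gap k.+1 c) ->
  K * f * influence k.+3 x <= gap k.+2 x.
Proof.
move=> K0 f0 hf hK; apply: le_trans (gap_step k.+1 x).
rewrite [influence k.+3 x]/= mulr_sumr; apply: ler_sum => c _.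
rewrite -/(influence k.+2 c).
have := hK c; have := hf c; rewrite /gap.
have := lt_le_trans rmin_gt0 (rmin_le_extreme_ratio k false c).
have [_ + + _] := extreme_ratio_sandwich k.+1 c.
have := influence_ge0 k.+2 c.
move: (extreme_ratio k.+1 true c) (extreme_ratio k.+1 false c) (influence k.+2 c) => hi lo S.
move=> S0 hlo hhi lo0 fr; set g := _ / _ - 1 => hg.
have r0 := r_gt0 c.
have -> : (hi - lo) / (1 + lo) = lo / (1 + lo) * g.
  by rewrite /g; field; rewrite !gt_eqF //; lra.
have -> : K * f * (occupation c * S) = (f * occupation c) * (K * S) by ring.
apply: ler_pM => //; [by rewrite mulr_ge0 ?occupation_ge0|by rewrite mulr_ge0|].
rewrite /occupation mulrA; apply: ler_pM => //; first by rewrite mulr_ge0 // ltW.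
  by rewrite invr_ge0; lra.
by rewrite lef_pV2 ?posrE; lra.
Qed.

(** The loss is [rmin / lam] on the [j0] levels next to the boundary, where mixing
    gives nothing, and [beta] on the others, where mixing makes the extremes
    agree up to the fraction [1 - beta]. *)
Lemma influence_bound (C alpha beta : R) (j0 n : nat) x : (0 < Delta)%N ->
  0 <= C -> 0 <= alpha -> alpha < 1 -> 0 < beta ->
  (forall k x, extreme_ratio k true x - extreme_ratio k false x <= C * alpha ^+ k.+1) ->
  (forall j, (j0 <= j)%N -> C * alpha ^+ j <= (1 - beta) * rmin) ->
  lam / Delta%:R * (rmin / lam) ^+ j0 * beta ^+ n * influence (j0 + n).+2 x
    <= C * alpha ^+ n / rmin.
Proof.
move=> D0 C0 a0 a1 b0 hC hj.
have l0 := lam_gt0; have d0 : 0 < Delta%:R :> R by rewrite ltr0n.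
have m0 := rmin_gt0.
apply: le_trans (_ : gap (j0 + n).+1 x <= _); last first.
  rewrite /gap; have := rmin_le_extreme_ratio (j0 + n) false x.
  have := hC (j0 + n).+1 x.
  move: (extreme_ratio _ true x) (extreme_ratio _ false x) => hi lo h1 h2.
  have lo0 : 0 < lo by apply: lt_le_trans h2.
  have -> : hi / lo - 1 = (hi - lo) / lo by field; rewrite gt_eqF.
  apply: le_trans (_ : C * alpha ^+ n / lo <= _); last first.
    by rewrite ler_wpM2l ?lef_pV2 ?posrE // mulr_ge0 ?exprn_ge0.
  rewrite ler_pM2r ?invr_gt0 //; apply: le_trans h1 _; apply: ler_wpM2l => //.
  apply: ler_wiXn2l; [exact: a0|exact: ltW|].
  exact: leq_trans (leq_addl j0 n) (leq_trans (leqnSn _) (leqnSn _)).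
have kap0 : 0 <= rmin / lam by rewrite divr_ge0 ?ltW.
elim: n x => [|n IH] x.
  rewrite addn0 expr0 mulr1.
  have {hj} _ := hj.
  elim: j0 x => [|j IH] x; first by rewrite expr0 mulr1; exact: gap_base.
  rewrite exprSr mulrA; apply: gap_next => //.
    by rewrite mulr_ge0 ?exprn_ge0 // divr_ge0 // ltW.
  move=> c; apply: le_trans (rmin_le_extreme_ratio j false c).
  rewrite mulrAC ler_pdivrMr // ler_wpM2l //; first exact: ltW.
  by have [_ _ h1 h2] := extreme_ratio_sandwich 0 c; exact: le_trans h1 h2.
have K0 : 0 <= lam / Delta%:R * (rmin / lam) ^+ j0 * beta ^+ n.
  by rewrite mulr_ge0 ?exprn_ge0 ?mulr_ge0 ?exprn_ge0 ?invr_ge0 // ltW.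
rewrite addnS exprSr mulrA; apply: gap_next => //; first exact: ltW.
move=> c; have [_ _ h1 _] := extreme_ratio_sandwich (j0 + n).+1 c.
have := hC (j0 + n).+1 c.
have := hj (j0 + n).+2 (leq_trans (leq_addr n j0) (ltnW (leqnSn _))).
have : (1 - beta) * rmin <= (1 - beta) * r c.
  apply: ler_wpM2l (rmin_le_r c); rewrite -(pmulr_lge0 _ m0).
  by apply: le_trans (hj j0 (leqnn _)); rewrite mulr_ge0 ?exprn_ge0.
lra.
Qed.

End Recursion.

(** The depth [l] depends only on the constants, not on the tree: this uniformity
    is what allows one radius for the whole family of graphs. *)
Lemma influence_decay (R : realType) (lam C alpha : R) (Delta : nat) :
  0 < lam -> (0 < Delta)%N -> 0 < C -> 0 <= alpha -> alpha < 1 ->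
  exists l : nat, forall (X : eqType) (ch : X -> seq X) (r : X -> R),
    (forall x, size (ch x) <= Delta)%N -> (forall x, 0 < r x) ->
    (forall x, r x = lam * \prod_(c <- ch x) (1 + r c)^-1) ->
    (forall k x, extreme_ratio ch lam k true x - extreme_ratio ch lam k false x
       <= C * alpha ^+ k.+1) ->
    forall x, influence ch r l x <= 4^-1.
Proof.
move=> l0 D0 C0 a0 a1.
pose rmin := lam / (1 + lam) ^+ Delta.
have m0 : 0 < rmin by rewrite divr_gt0 ?exprn_gt0 ?addr_gt0.
(* the loss per level has to be smaller than the gain [1 / alpha] from mixing *)
pose beta := (1 + alpha) / 2.
have b0 : 0 < beta by rewrite /beta; lra.
have b1 : beta < 1 by rewrite /beta; lra.
have [j0 hj0] : exists j0, forall j, (j0 <= j)%N -> alpha ^+ j <= (1 - beta) * rmin / C.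
  by apply: expr_eventually_le => //; rewrite divr_gt0 // mulr_gt0 ?subr_gt0.
pose c0 := lam / Delta%:R * (rmin / lam) ^+ j0.
have c00 : 0 < c0 by rewrite mulr_gt0 ?exprn_gt0 // divr_gt0 // ltr0n.
have [n hn] : exists n, forall m, (n <= m)%N ->
    (alpha / beta) ^+ m <= c0 * rmin / C / 4.
  apply: expr_eventually_le.
  - by rewrite divr_ge0 // ltW.
  - by rewrite ltr_pdivrMr // mul1r /beta; lra.
  - by rewrite !divr_gt0 // mulr_gt0.
exists (j0 + n).+2 => X ch r hs hr hrec hC x.
have := @influence_bound R X ch lam Delta r l0 hs hr hrec C alpha beta j0 n x D0
  (ltW C0) a0 a1 b0 hC.
have hj j : (j0 <= j)%N -> C * alpha ^+ j <= (1 - beta) * rmin.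
  by move=> hj; rewrite mulrC -ler_pdivlMr // hj0.
move=> /(_ hj); rewrite -/rmin -/c0 => h.
have := hn n (leqnn n); rewrite expr_div_n ler_pdivrMr ?exprn_gt0 // => h2.
have cb : 0 < c0 * beta ^+ n by rewrite mulr_gt0 // exprn_gt0.
rewrite -(ler_pM2l cb); apply: le_trans h _.
rewrite ler_pdivrMr //; apply: le_trans (ler_wpM2l (ltW C0) h2) _.
rewrite le_eqVlt; apply/orP; left; apply/eqP; field.
by rewrite gt_eqF.
Qed.

(** * Propagation of a complex perturbation *)

Section Perturbation.
Variable R : rcfType.
Local Notation N := (@ComplexField.Normc.normc R).
Implicit Types z w : R[i].

Lemma nrm1 : N 1 = 1. Proof. exact: ComplexField.Normc.normc1. Qed.
Lemma nrm0 : N 0 = 0. Proof. exact: ComplexField.Normc.normc0. Qed.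
Lemma nrmM z w : N (z * w) = N z * N w.
Proof. exact: ComplexField.Normc.normcM. Qed.
Lemma nrmV z : N z^-1 = (N z)^-1.
Proof. exact: ComplexField.Normc.normcV. Qed.
Lemma nrmN z : N (- z) = N z. Proof. exact: normcN. Qed.
Lemma nrmD z w : N (z + w) <= N z + N w. Proof. exact: le_normcD. Qed.
Lemma nrmR (a : R) : N (a%:C)%C = `|a|.
Proof. by rewrite /= expr0n /= addr0 sqrtr_sqr. Qed.
Lemma nrm_ge0 z : 0 <= N z.
Proof. by case: z => a b; rewrite sqrtr_ge0. Qed.
Lemma nrm_def z : `|z| = ((N z)%:C)%C. Proof. by case: z. Qed.

Lemma nrm_1D z : 1 - N z <= N (1 + z).
Proof.
have := nrmD (1 + z) (- z); rewrite addrK nrm1 nrmN; lra.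
Qed.

Lemma nrm_prod1 (I : eqType) (s : seq I) (u : I -> R[i]) :
  N (\prod_(c <- s) (1 + u c) - 1) <= \prod_(c <- s) (1 + N (u c)) - 1.
Proof.
elim: s => [|a s IH]; first by rewrite !big_nil !subrr nrm0.
rewrite !big_cons.
move: IH; set P := \prod_(c <- s) _; set Q := \prod_(c <- s) _ => IH.
have -> : (1 + u a) * P - 1 = (1 + u a) * (P - 1) + u a by ring.
apply: le_trans (nrmD _ _) _; rewrite nrmM.
have h1 := nrmD 1 (u a); rewrite nrm1 in h1.
have h2 := nrm_ge0 (P - 1); have h3 := nrm_ge0 (u a); have h4 := nrm_ge0 (1 + u a).
have : N (1 + u a) * N (P - 1) <= (1 + N (u a)) * (Q - 1) by apply: ler_pM.
lra.
Qed.

Lemma nrm_inv_sub1 z (d : R) : N z <= d -> d < 1 ->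
  N ((1 + z)^-1 - 1) <= (1 - d)^-1 * N z /\ 1 + N ((1 + z)^-1 - 1) <= (1 - d)^-1.
Proof.
move=> zd d1; have z0 := nrm_ge0 z; have h := nrm_1D z.
have nz : 1 + z != 0.
  by apply/eqP => h0; move: h; rewrite h0 nrm0; lra.
have -> : (1 + z)^-1 - 1 = - z * (1 + z)^-1 by field.
rewrite nrmM nrmN nrmV.
have hi : (N (1 + z))^-1 <= (1 - d)^-1 by rewrite lef_pV2 ?posrE; lra.
have key : N z * (N (1 + z))^-1 <= (1 - d)^-1 * N z.
  by rewrite mulrC ler_wpM2r.
split=> //.
have : (1 - d)^-1 * N z <= (1 - d)^-1 * d.
  by apply: ler_wpM2l => //; rewrite invr_ge0; lra.
have : (1 - d)^-1 * d = (1 - d)^-1 - 1 by field; rewrite gt_eqF //; lra.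
lra.
Qed.

(** To first order the error is [eta - sum_c p c * e c]. The higher-order terms are
    absorbed in a factor that tends to 1 as [d] tends to 0, so that a bounded
    number of steps multiplies the linear bound by at most a constant. *)
Lemma relative_error_step (X : eqType) (s : seq X) (p : X -> R) (e : X -> R[i])
    (eta : R[i]) (d eps : R) (D : nat) :
  (size s <= D)%N -> d < 1 -> eps <= d -> N eta <= eps ->
  {in s, forall c, [/\ 0 <= p c, p c <= 1 & N (e c) <= d]} ->
  N ((1 + eta) * \prod_(c <- s) (1 + (p c)%:C%C * e c)^-1 - 1)
    <= (1 - d)^-1 ^+ D.+2 * \sum_(c <- s) p c * N (e c) + eps.
Proof.
move=> sD d1 ed he hs; set M := (1 - d)^-1.
have e0 := nrm_ge0 eta.
have M1 : 1 <= M by rewrite -[leLHS]invr1 lef_pV2 ?posrE; lra.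
pose u c := (1 + (p c)%:C%C * e c)^-1 - 1.
have hu : {in s, forall c, N (u c) <= M * (p c * N (e c)) /\ 1 + N (u c) <= M}.
  move=> c /hs[p0 p1 ec].
  have zE : N ((p c)%:C%C * e c) = p c * N (e c) by rewrite nrmM nrmR ger0_norm.
  rewrite -zE; apply: nrm_inv_sub1 => //; rewrite zE.
  by apply: le_trans ec; rewrite ler_piMl // nrm_ge0.
have -> : \prod_(c <- s) (1 + (p c)%:C%C * e c)^-1 = \prod_(c <- s) (1 + u c).
  by apply: eq_bigr => c _; rewrite /u addrCA subrr addr0.
have h1 : N (\prod_(c <- s) (1 + u c) - 1) <= M ^+ D.+1 * \sum_(c <- s) p c * N (e c).
  apply: le_trans (nrm_prod1 _ _) _.
  apply: le_trans (prod_sub1_le M1 sD _) _.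
    by move=> c cs; split; [exact: nrm_ge0|case: (hu c cs)].
  rewrite exprSr -mulrA; apply: ler_wpM2l; first by rewrite exprn_ge0; lra.
  rewrite mulr_sumr big_seq [leRHS]big_seq; apply: ler_sum => c cs.
  by case: (hu c cs).
move: h1; set P := \prod_(c <- s) _; set S := \sum_(c <- s) _ => h1.
have -> : (1 + eta) * P - 1 = (1 + eta) * (P - 1) + eta by ring.
apply: le_trans (nrmD _ _) _; apply: lerD => //.
rewrite nrmM exprS -mulrA; apply: ler_pM => //; try exact: nrm_ge0.
apply: le_trans (nrmD _ _) _; rewrite nrm1.
have : (1 + d) * (1 - d) <= 1 by have := sqr_ge0 d; rewrite expr2; lra.
rewrite -ler_pdivlMr ?subr_gt0 // mul1r -/M; lra.
Qed.

(** The [l]-fold iteration of the one-step bound: an error [d] at depth [l] reaches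
    the root multiplied by the influence, and the at most [D ^ j] vertices at depth
    [j < l] contribute their own parameter errors. The bound [d] is
    known below measure [n] only; for [l > 0] it is used at proper descendants,
    whence the bound [n + (0 < l)] on the measure of [x]. *)
Lemma relative_error_iter (X : eqType) (ch : X -> seq X) (r : X -> R)
    (e : X -> R[i]) (m : X -> nat) (n D : nat) (g d eps : R) :
  0 <= g -> 0 <= eps -> (forall x, size (ch x) <= D)%N -> (forall x, 0 < r x) ->
  (forall x, {in ch x, forall c, (m c < m x)%N}) ->
  (forall x, (m x <= n)%N ->
     N (e x) <= g * \sum_(c <- ch x) occupation r c * N (e c) + eps) ->
  (forall x, (m x < n)%N -> N (e x) <= d) ->
  forall l x, (m x < n + (0 < l))%N ->
  N (e x) <= g ^+ l * influence ch r l x * d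
             + eps * \sum_(j < l) (g * D%:R) ^+ j.
Proof.
move=> g0 eps0 hD r0 hm hstep hd; elim=> [|l IH] x.
  by rewrite addn0 big_ord0 mulr0 addr0 expr0 !mul1r; exact: hd.
rewrite addn1 ltnS => mx; apply: le_trans (hstep x mx) _.
set B := \sum_(j < l) _ in IH.
have B0 : 0 <= B by apply: sumr_ge0 => j _; rewrite exprn_ge0 ?mulr_ge0.
have -> : \sum_(j < l.+1) (g * D%:R) ^+ j = 1 + g * D%:R * B.
  rewrite big_ord_recl expr0 mulr_sumr; congr (1 + _).
  by apply: eq_bigr => j _; rewrite -exprS.
apply: le_trans (_ : g * \sum_(c <- ch x) (occupation r c *
    (g ^+ l * influence ch r l c * d) + occupation r c * (eps * B)) + eps <= _).
  rewrite lerD2r; apply: ler_wpM2l => //.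
  rewrite big_seq [leRHS]big_seq; apply: ler_sum => c cx.
  rewrite -mulrDr; apply: ler_wpM2l; first exact: occupation_ge0.
  by apply: IH; apply: leq_trans (leq_addr _ _); apply: leq_trans (hm x c cx) mx.
rewrite big_split /= -mulr_suml mulrDr.
have -> : g * \sum_(c <- ch x) occupation r c * (g ^+ l * influence ch r l c * d) =
    g ^+ l.+1 * (\sum_(c <- ch x) occupation r c * influence ch r l c) * d.
  rewrite [LHS]mulr_sumr [in RHS]mulr_sumr mulr_suml.
  by apply: eq_bigr => c _; rewrite exprS; ring.
rewrite -addrA lerD2l.
have := ler_wpM2l (mulr_ge0 g0 (mulr_ge0 eps0 B0)) (@sum_occupation_le R X ch D r hD r0 x).
lra.
Qed.

(** After [l] levels the error [d] comes back as at most [2 * d / 4], leaving room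
    for the parameter errors: the bound [d] is inherited by induction on any measure
    that decreases along the tree. *)
Lemma relative_error_contraction (D l : nat) :
  exists d eps : R, [/\ 0 < d, d < 1, 0 < eps &
  forall (X : eqType) (ch : X -> seq X) (r : X -> R) (e : X -> R[i])
    (m : X -> nat) (n : nat),
  (forall x, size (ch x) <= D)%N -> (forall x, 0 < r x) ->
  (forall x, influence ch r l x <= 4^-1) ->
  (forall x, {in ch x, forall c, (m c < m x)%N}) ->
  (forall x, (m x <= n)%N -> exists2 eta, N eta <= eps &
     1 + e x = (1 + eta) * \prod_(c <- ch x) (1 + (occupation r c)%:C%C * e c)^-1) ->
  (forall x, (m x < n)%N -> N (e x) <= d) ->
  forall x, (m x <= n)%N -> N (e x) <= d].
Proof.
(* [d] is such that [(1 - d) ^ ((D + 2) * (l + 1)) >= 1/2], by Bernoulli *)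
have [K KE] : exists K : R, K = (D.+2 * l.+1)%:R by exists (D.+2 * l.+1)%:R.
have K1 : 1 <= K by rewrite KE ler1n muln_gt0.
have [d [dK d0 d1]] : exists d, [/\ K * d = 2^-1, 0 < d & d < 1].
  have K0 : 0 < K := lt_le_trans ltr01 K1.
  exists (2 * K)^-1; split; first by field; rewrite gt_eqF.
    by rewrite invr_gt0 mulr_gt0.
  by rewrite invf_lt1 ?mulr_gt0 //; lra.
pose g : R := (1 - d)^-1 ^+ D.+2.
have g0 : 0 <= g by rewrite exprn_ge0 // invr_ge0; lra.
have gl : g ^+ l <= 2.
  rewrite -exprM exprVn -[leRHS]invrK lef_pV2 ?posrE ?exprn_gt0 ?subr_gt0 ?invr_gt0 //.
  apply: le_trans (_ : (1 - d) ^+ (D.+2 * l.+1) <= _).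
    by have := bernoulli (D.+2 * l.+1) (ltW d0) (ltW d1); rewrite -KE dK; lra.
  apply: ler_wiXn2l; [lra|lra|].
  by rewrite leq_pmul2l.
pose B := \sum_(j < l) (g * D%:R) ^+ j.
have B0 : 0 <= B.
  by apply: sumr_ge0 => j _; exact: exprn_ge0 (mulr_ge0 g0 (ler0n _ _)).
(* the accumulated parameter errors amount to at most [d / 2] *)
pose eps : R := d / (2 * (1 + B)).
have eps0 : 0 < eps by apply: divr_gt0 => //; lra.
have epsB : eps * (1 + B) = d / 2 by rewrite /eps; field; rewrite gt_eqF //; lra.
have epsd : eps <= d by have := mulr_ge0 (ltW eps0) B0; lra.
exists d; exists eps; split=> // X ch r e m n hD r0 hI hm hrec hd x mx.
have l0 : (0 < l)%N.
  by case: (l) (hI x) => //=; lra.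
have hstep y : (m y <= n)%N ->
    N (e y) <= g * \sum_(c <- ch y) occupation r c * N (e c) + eps.
  move=> my; have [eta he hE] := hrec y my.
  have -> : e y = 1 + e y - 1 by ring.
  rewrite hE; apply: relative_error_step => // c cy; split.
  - exact: occupation_ge0.
  - exact: occupation_le1.
  - by apply: hd; apply: leq_trans (hm y c cy) my.
have := relative_error_iter g0 (ltW eps0) hD r0 hm hstep hd (l := l) (x := x).
rewrite l0 addn1 ltnS -/B => /(_ mx) /le_trans; apply.
have i0 := influence_ge0 ch r0 l x.
have : g ^+ l * influence ch r l x <= 2 * 4^-1.
  by apply: ler_pM => //; rewrite exprn_ge0.
move/(ler_wpM2r (ltW d0)); lra.
Qed.

End Perturbation.

(** * Ratios in a graph and the tree of self avoiding walks *)

Lemma independentP (G : sgraph) (I : {set G}) :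
  reflect {in I &, forall x y, ~~ adj x y} (independent I).
Proof.
apply: (iffP forall_inP) => [h x y xI yI|h x xI].
  by have /forall_inP := h x xI; exact.
by apply/forall_inP => y yI; exact: h.
Qed.

Section InducedPolynomial.
Variables (G : sgraph) (K : fieldType) (lam : G -> K).

Definition induced_poly (A : {set G}) : K :=
  \sum_(I : {set G} | (I \subset A) && independent I) \prod_(v in I) lam v.

(** The ratio of the occupied to the unoccupied part of the partition function of
    the subgraph induced by [x.1], at the vertex [x.2]. *)
Definition vertex_ratio (x : {set G} * G) : K :=
  lam x.2 * induced_poly ((x.1 :\ x.2) :\: neighbours x.2)
  / induced_poly (x.1 :\ x.2).

Lemma induced_poly_setT : induced_poly [set: G] = indep_poly lam.
Proof. by apply: eq_bigl => I; rewrite subsetT. Qed.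

Lemma independent_setU1 (v : G) (J : {set G}) :
  independent (v |: J) = independent J && (J \subset ~: neighbours v).
Proof.
apply/independentP/andP => [h|[/independentP hJ hN]].
  split; first by apply/independentP => x y xJ yJ; apply: h; rewrite !inE ?xJ ?yJ orbT.
  by apply/subsetP => y yJ; rewrite !inE; apply: h; rewrite !inE ?eqxx ?yJ ?orbT.
have hv y : y \in J -> ~~ adj v y by move=> /(subsetP hN); rewrite !inE.
move=> x y /setU1P[->|xJ] /setU1P[->|yJ]; rewrite ?adj_irr //.
- exact: hv.
- by rewrite adj_sym; exact: hv.
- exact: hJ.
Qed.

Lemma induced_poly_del (A : {set G}) (v : G) : v \in A ->
  induced_poly A =
  induced_poly (A :\ v) + lam v * induced_poly ((A :\ v) :\: neighbours v).
Proof.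
move=> vA; rewrite /induced_poly (bigID (fun I : {set G} => v \in I)) /= addrC.
congr (_ + _).
  by apply: eq_bigl => I; rewrite subsetD1 andbAC.
rewrite (reindex_onto (fun J => v |: J) (fun I => I :\ v)); last first.
  by move=> I /andP[_ vI]; rewrite setD1K.
rewrite mulr_sumr; apply: eq_big => [J|J].
  rewrite setU11 andbT independent_setU1 subUset sub1set vA /=.
  have -> : ((v |: J) :\ v == J) = (v \notin J).
    apply/eqP/idP => [<-|vJ]; first by rewrite !inE eqxx.
    by rewrite setU1K.
  rewrite [_ :\: neighbours v]setDE subsetI subsetD1.
  by case: (J \subset A); case: (v \notin J); rewrite /= ?andbF ?andbT // andbC.
case/andP=> _ /eqP vJ; rewrite big_setU1 //.
by rewrite -vJ !inE eqxx.
Qed.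

Lemma one_plus_vertex_ratioE (A : {set G}) (v : G) : v \in A ->
  induced_poly (A :\ v) != 0 ->
  1 + vertex_ratio (A, v) = induced_poly A / induced_poly (A :\ v).
Proof.
by move=> vA nz; rewrite (induced_poly_del vA) mulrDl divff.
Qed.

End InducedPolynomial.

Section SawStates.
Variables (G : sgraph) (le : rel G).

(** The states of the tree of self avoiding walks are the pairs (remaining vertex
    set, current vertex) from which its subtrees are built. *)
Fixpoint branch_states (A : {set G}) (ws : seq G) : seq ({set G} * G) :=
  if ws is w :: ws' then (A, w) :: branch_states (A :\ w) ws' else [::].

Definition saw_children (x : {set G} * G) : seq ({set G} * G) :=
  branch_states (x.1 :\ x.2) (sorted_neighbours le x.1 x.2).

Lemma branchesE (t : {set G} -> G -> rgraph) A ws :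
  branches t A ws = [seq t c.1 c.2 | c <- branch_states A ws].
Proof. by elim: ws A => //= w ws IH A; rewrite IH. Qed.

Lemma saw_children_size x : (size (saw_children x) <= max_degree G)%N.
Proof.
have -> : size (saw_children x) = #|neighbours x.2 :&: x.1|.
  rewrite /saw_children cardE -(size_sort le) -/(sorted_neighbours le x.1 x.2).
  move: (sorted_neighbours _ _ _) (x.1 :\ x.2).
  by elim=> //= w ws IH A; rewrite IH.
apply: leq_trans (subset_leq_card (subsetIl _ _)) _.
exact: (leq_bigmax x.2).
Qed.

Lemma branch_statesP (A : {set G}) (ws : seq G) c : uniq ws -> {subset ws <= A} ->
  c \in branch_states A ws -> c.1 \subset A /\ c.2 \in c.1.
Proof.
elim: ws A => //= w ws IH A /andP[wws uws] sA.
rewrite inE => /orP[/eqP->|/IH] /=; first by split=> //; apply: sA; rewrite mem_head.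
case=> // [x xws|cA cc].
  rewrite !inE sA ?inE ?xws ?orbT // andbT.
  by apply: contraNneq wws => <-.
by split=> //; apply: subset_trans cA (subsetDl _ _).
Qed.

Lemma saw_childrenP x c : c \in saw_children x ->
  c.1 \subset x.1 :\ x.2 /\ c.2 \in c.1.
Proof.
apply: branch_statesP; first exact: sorted_neighbours_uniq.
exact: sorted_neighbours_sub.
Qed.

Lemma saw_children_card x c : c \in saw_children x ->
  (#|c.1 :\ c.2| < #|x.1 :\ x.2|)%N.
Proof.
case/saw_childrenP=> sub cc; apply: leq_trans (subset_leq_card sub).
by rewrite (cardsD1 c.2 c.1) cc.
Qed.

Variables (K : fieldType) (lam : G -> K).

(** Each factor is [Z A / Z (A - w)], the weight of deleting one more vertex. *)
Lemma vertex_ratio_telescope (A : {set G}) (ws : seq G) : uniq ws -> {subset ws <= A} ->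
  (forall B : {set G}, B \subset A -> induced_poly lam B != 0) ->
  \prod_(c <- branch_states A ws) (1 + vertex_ratio lam c)
    = induced_poly lam A / induced_poly lam (A :\: [set x in ws]).
Proof.
elim: ws A => [|w ws IH] A /=.
  move=> _ _ nz; rewrite big_nil.
  have -> : A :\: [set x in [::]] = A.
    by apply/setP => x; rewrite !inE.
  by rewrite divff ?nz.
move=> /andP[wws uws] sA nz.
have sDA : A :\ w \subset A by exact: subsetDl.
rewrite big_cons one_plus_vertex_ratioE ?nz ?sA ?mem_head //.
rewrite IH //; first last.
- by move=> B sB; apply: nz; apply: subset_trans sB sDA.
- move=> x xws; rewrite !inE sA ?inE ?xws ?orbT // andbT.
  by apply: contraNneq wws => <-.
have -> : A :\ w :\: [set x in ws] = A :\: [set x in w :: ws].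
  by apply/setP => x; rewrite !inE negb_or; case: (x \in ws); case: (x == w).
by rewrite mulrA divfK ?nz.
Qed.

(** Deleting the neighbours of the root one by one, in the order in which the tree
    of self avoiding walks lists them, leads from [A - v] to [A - N[v]]. *)
Lemma vertex_ratio_rec x :
  (forall B : {set G}, B \subset x.1 :\ x.2 -> induced_poly lam B != 0) ->
  vertex_ratio lam x = lam x.2 * \prod_(c <- saw_children x) (1 + vertex_ratio lam c)^-1.
Proof.
move=> nz; rewrite prodfV vertex_ratio_telescope //; first last.
- exact: sorted_neighbours_sub.
- exact: sorted_neighbours_uniq.
rewrite /vertex_ratio invf_div mulrA.
congr (_ * induced_poly _ _ / _); apply/setP => y.
rewrite !inE mem_sort mem_enum !inE.
by case: (y == x.2); case: (y \in x.1); rewrite ?andbF ?andbT.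
Qed.

End SawStates.

(** * Partition functions on rooted trees *)

Section TwoState.
Variable K : fieldType.

(** Every vertex carries one weight for being in and one for being out. This covers
    vertices fixed by a boundary condition, the root included, and unlike the
    one-parameter polynomial it also allows a vertex to be forced in. *)
Definition two_state (T : rgraph) (f : T -> bool -> K) (b : bool) : K :=
  \sum_(J : {set T} | independent J && ((root T \in J) == b))
    \prod_x f x (x \in J).

Lemma eq_two_state (T : rgraph) (f g : T -> bool -> K) b :
  (forall x c, f x c = g x c) -> two_state f b = two_state g b.
Proof. by move=> fg; apply: eq_bigr => J _; apply: eq_bigr => x _. Qed.

Lemma two_state_total (T : rgraph) (f : T -> bool -> K) :
  two_state f true + two_state f false =
  \sum_(J : {set T} | independent J) \prod_x f x (x \in J).
Proof.
rewrite [RHS](bigID (fun J : {set T} => root T \in J)) /=.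
by congr (_ + _); apply: eq_bigl => J; case: (root T \in J).
Qed.

Definition merge_sets (T B : rgraph) (p : {set T} * {set B}) : {set attach T B} :=
  [set z | match z with inl a => a \in p.1 | inr c => c \in p.2 end].

Lemma merge_sets_bij (T B : rgraph) : bijective (@merge_sets T B).
Proof.
exists (fun J : {set attach T B} =>
  ([set a | (inl a : attach T B) \in J], [set c | (inr c : attach T B) \in J])).
  by case=> I J; congr pair; apply/setP => x; rewrite !inE.
by move=> J; apply/setP => -[a|c]; rewrite !inE.
Qed.

Lemma independent_merge_sets (T B : rgraph) (p : {set T} * {set B}) :
  independent (merge_sets p) =
  [&& independent p.1, independent p.2 & ~~ ((root T \in p.1) && (root B \in p.2))].
Proof.
case: p => I J; apply/independentP/and3P => /= [h|[/independentP hI /independentP hJ hr]].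
  split.
  - by apply/independentP => x y xI yI; apply: (h (inl x) (inl y)); rewrite inE.
  - by apply/independentP => x y xI yI; apply: (h (inr x) (inr y)); rewrite inE.
  apply/andP => -[rI rJ].
  by have := h (inl (root T)) (inr (root B)); rewrite !inE /= !eqxx => /(_ rI rJ).
move=> [x|x] [y|y]; rewrite !inE /= => hx hy; [exact: hI| | |exact: hJ].
  by apply: contra hr => /andP[/eqP<- /eqP<-]; rewrite hx hy.
by apply: contra hr => /andP[/eqP<- /eqP<-]; rewrite hx hy.
Qed.

(** The only constraint between the two sides is that the roots are not both in. *)
Lemma two_state_attach (T B : rgraph) (f : attach T B -> bool -> K) b :
  two_state f b =
  two_state (fun a => f (inl a)) b *
  (if b then 0 else two_state (fun c => f (inr c)) true)
  + two_state (fun a => f (inl a)) b * two_state (fun c => f (inr c)) false.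
Proof.
have -> : two_state f b = \sum_(p : {set T} * {set B} |
    [&& independent p.1, independent p.2,
        ~~ ((root T \in p.1) && (root B \in p.2)) & (root T \in p.1) == b])
    (\prod_a f (inl a) (a \in p.1)) * (\prod_c f (inr c) (c \in p.2)).
  rewrite /two_state (reindex (@merge_sets T B)); last exact: onW_bij (merge_sets_bij _ _).
  apply: eq_big => [p|p _].
    by rewrite independent_merge_sets inE /= -!andbA.
  by rewrite big_sumType /=; congr (_ * _); apply: eq_bigr => x _; rewrite inE.
rewrite -mulrDr; case: b.
  rewrite add0r /two_state big_distrlr pair_big /=; apply: eq_bigl => -[I J] /=.
  by case: (root T \in I); case: (root B \in J); rewrite ?andbT ?andbF.
rewrite two_state_total /two_state big_distrlr pair_big /=.
apply: eq_bigl => -[I J] /=.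
by case: (root T \in I); rewrite ?andbT ?andbF.
Qed.

Definition bc_weight (T : Type) (lam : K) (s : T -> option bool) (x : T)
    (c : bool) : K :=
  if s x is Some b then (c == b)%:R else if c then lam else 1.

(** The sets that contribute to the right-hand side contain exactly the fixed
    vertices that are fixed in, and are the sets [I :|: bc_in s]; any other set
    meets a weight 0. *)
Lemma bc_sum_two_state (T : rgraph) (s : {ffun T -> option bool}) (lam : K) b :
  s (root T) = None ->
  \sum_(I : {set T} | [&& (root T \in I) == b, I \subset ~: bc_dom s
                        & independent (I :|: bc_in s)]) lam ^+ #|I|
  = two_state (bc_weight lam s) b.
Proof.
move=> s0.
rewrite /two_state [RHS](bigID (fun J : {set T} => J :&: bc_dom s == bc_in s)) /=.
rewrite [X in _ + X]big1 ?addr0; last first.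
  move=> J /andP[_ hJ].
  case: (pickP (fun x => (s x != None) && (s x != Some (x \in J)))) => [x|none].
    rewrite (bigD1 x) //= /bc_weight; case: (s x) => // c /eqP h.
    have -> : ((x \in J) == c) = false by apply/eqP => h'; apply: h; rewrite h'.
    by rewrite mul0r.
  case/eqP: hJ; apply/setP => x; have := none x; rewrite !inE.
  case: (s x) => [c|] /=; last by rewrite andbF.
  by move=> /negbFE/eqP ->; rewrite andbT; case: (x \in J).
rewrite [RHS](reindex_onto (fun I => I :|: bc_in s) (fun J => J :\: bc_dom s)).
  have r0 : root T \in bc_in s = false by rewrite inE s0.
  apply: eq_big => [I|I].
    rewrite in_setU r0 orbF.
    have -> : ((I :|: bc_in s) :\: bc_dom s == I) = (I \subset ~: bc_dom s).
      apply/eqP/subsetP => [<- x|h]; first by rewrite !inE => /andP[].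
      apply/setP => x; have := h x; rewrite !inE.
      by case: (x \in I) => [->//|_]; case: (s x) => [[]|].
    have [sI|] := boolP (I \subset ~: bc_dom s); last by rewrite !andbF.
    rewrite andbT /=.
    have -> : (I :|: bc_in s) :&: bc_dom s == bc_in s.
      apply/eqP/setP => x; have := subsetP sI x; rewrite !inE.
      by case: (x \in I) => [/(_ isT)/negbNE/eqP->//|_]; case: (s x) => [[]|].
    by rewrite andbT andbC.
  case/and3P=> _ sI _; rewrite -prodr_const big_mkcond; apply: eq_bigr => x _.
  rewrite /bc_weight !inE; have := subsetP sI x; rewrite !inE.
  case: (x \in I) => [/(_ isT)/negbNE/eqP->//|_] /=.
  by case: (s x) => [[]|].
move=> J /andP[_ /eqP <-]; apply/setP => x; rewrite !inE.
by case: (x \in J); case: (s x).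
Qed.

Lemma ratio_two_state (T : rgraph) (s : {ffun T -> option bool}) (lam : K) :
  s (root T) = None ->
  ratio s (root T) lam =
  two_state (bc_weight lam s) true / two_state (bc_weight lam s) false.
Proof.
move=> s0; rewrite -!bc_sum_two_state //; congr (_ / _); apply: eq_bigl => I.
  by rewrite eqb_id.
by rewrite eqbF_neg.
Qed.

End TwoState.

(** * Distance layers of rooted trees *)

Section Layers.
Implicit Types T B : rgraph.

(** A height function certifying all distances to the root at once. That adjacent
    vertices have different heights makes the graph bipartite, so that a whole
    sphere can be fixed in. *)
Definition depth_function T (d : T -> nat) : Prop :=
  [/\ forall y, (d y == 0) = (y == root T),
      forall x y, adj x y -> d y = (d x).+1 \/ d x = (d y).+1 &
      forall y n, d y = n.+1 -> exists2 x, adj x y & d x = n].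

Definition layered T : Prop := exists d : T -> nat, depth_function d.

Lemma sphere_depth T (d : T -> nat) l : depth_function d ->
  sphere (root T) l = [set x | d x == l].
Proof.
case=> dr dadj dpred.
have d0 : d (root T) = 0%N by apply/eqP; rewrite dr.
have upper p x : path (@adj T) x p -> (d (last x p) <= d x + size p)%N.
  elim: p x => [|a p IH] x /=; first by rewrite addn0.
  case/andP=> xa /IH; move=> h; apply: leq_trans h _.
  by rewrite addnS -addSn leq_add2r; case: (dadj _ _ xa) => -> //; exact: leqW.
have walk_le n y : walk n (root T) y -> (d y <= n)%N.
  case/existsP=> p /andP[hp /eqP <-].
  by have := upper _ _ hp; rewrite d0 size_tuple.
have walk_depth n y : d y = n -> walk n (root T) y.
  suff: d y = n -> exists p, [/\ path (@adj T) (root T) p, last (root T) p = y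
                               & size p = n].
    move=> h /h[p [hp lp sp]]; apply/existsP.
    by exists (tcast sp (in_tuple p)); rewrite val_tcast hp lp eqxx.
  elim: n y => [|n IH] y dy.
    by exists [::]; split=> //=; apply/esym/eqP; rewrite -dr dy.
  have [x xy /IH[p [hp lp sp]]] := dpred y n dy.
  by exists (rcons p y); rewrite rcons_path last_rcons size_rcons hp lp sp.
apply/setP => y; rewrite !inE; apply/andP/eqP => [[w /forallP nw]|dy].
  apply/eqP; rewrite eqn_leq (walk_le _ _ w) leqNgt; apply/negP => lt.
  by have /negP := nw (Ordinal lt); apply; exact: walk_depth.
split; first exact: walk_depth.
apply/forallP => k; apply/negP => /walk_le.
by rewrite dy leqNgt ltn_ord.
Qed.

Lemma sphere_independent T l : layered T -> independent (sphere (root T) l).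
Proof.
case=> d hd; rewrite (sphere_depth l hd); have [_ dadj _] := hd.
apply/independentP => x y; rewrite !inE => /eqP dx /eqP dy; apply/negP => /dadj.
by rewrite dx dy => -[] /eqP; rewrite ?(ltn_eqF (ltnSn l)).
Qed.

Lemma root_sphere T l : layered T -> (root T \in sphere (root T) l) = (l == 0)%N.
Proof.
case=> d hd; rewrite (sphere_depth l hd) inE; case: hd => dr _ _.
have /eqP -> : d (root T) == 0%N by rewrite dr.
by rewrite eq_sym.
Qed.

Definition attach_depth T B (dT : T -> nat) (dB : B -> nat) (x : attach T B) : nat :=
  match x with inl a => dT a | inr b => (dB b).+1 end.

Lemma attach_depth_function T B dT dB :
  depth_function dT -> depth_function dB ->
  depth_function (@attach_depth T B dT dB).
Proof.
move=> [rT aT pT] [rB aB pB].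
have dT0 : dT (root T) = 0%N by apply/eqP; rewrite rT.
have dB0 : dB (root B) = 0%N by apply/eqP; rewrite rB.
split.
- by case=> [a|b] //=; rewrite rT.
- case=> [a|b] [a'|b'] //=.
  + exact: aT.
  + by case/andP=> /eqP-> /eqP->; rewrite dT0 dB0; left.
  + by case/andP=> /eqP-> /eqP->; rewrite dT0 dB0; right.
  + by move=> /aB[->|->]; [left|right].
- case=> [a|b] n /=; first by move=> /pT[x xa dx]; exists (inl x).
  case: n => [|n] [] dn; last by have [x xb dx] := pB _ _ dn; exists (inr x); rewrite //= dx.
  exists (inl (root T)) => //=; rewrite eqxx /=.
  by rewrite -rB dn.
Qed.

Lemma layered_attach T B : layered T -> layered B -> layered (attach T B).
Proof.
by move=> [dT hT] [dB hB]; exists (attach_depth dT dB); exact: attach_depth_function.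
Qed.

Lemma layered_point : layered point.
Proof. by exists (fun=> 0%N); split=> // -[]. Qed.

Lemma layered_join_root (X : Type) (t : X -> rgraph) (s : seq X) :
  (forall x, layered (t x)) -> layered (join_root [seq t x | x <- s]).
Proof.
move=> ht; elim: s => [|x s IH]; first exact: layered_point.
exact: layered_attach.
Qed.

Lemma layered_saw_tree (G : sgraph) (le : rel G) (A : {set G}) v :
  layered (saw_tree le A v).
Proof.
rewrite /saw_tree; move: #|A| => n; elim: n A v => [|n IH] A v /=; first exact: layered_point.
by rewrite branchesE; apply: layered_join_root => c.
Qed.

Lemma sphere_attach_inl T B l (a : T) : layered T -> layered B ->
  ((inl a : attach T B) \in sphere (root (attach T B)) l) = (a \in sphere (root T) l).
Proof.
move=> [dT hT] [dB hB].
by rewrite (sphere_depth l (attach_depth_function hT hB)) (sphere_depth l hT) !inE.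
Qed.

Lemma sphere_attach_inr T B l (b : B) : layered T -> layered B ->
  ((inr b : attach T B) \in sphere (root (attach T B)) l.+1) = (b \in sphere (root B) l).
Proof.
move=> [dT hT] [dB hB].
by rewrite (sphere_depth _ (attach_depth_function hT hB)) (sphere_depth l hB) !inE.
Qed.

End Layers.
(** * Trees with a uniformly fixed sphere *)

Section UniformBoundary.
Variables (R : realFieldType) (lam : R).
Hypothesis lam_gt0 : 0 < lam.
Implicit Types T B : rgraph.

Definition uniform_bc T (l : nat) (b : bool) : {ffun T -> option bool} :=
  [ffun x => if x \in sphere (root T) l then Some b else None].

Definition bc_state T l b (c : bool) : R :=
  two_state (bc_weight lam (uniform_bc T l b)) c.

Definition sphere_ratio T k b : R :=
  bc_state T k.+1 b true / bc_state T k.+1 b false.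

Definition out_prob T l b : R :=
  bc_state T l b false / (bc_state T l b true + bc_state T l b false).

Lemma uniform_bc_dom T l b : bc_dom (uniform_bc T l b) = sphere (root T) l.
Proof. by apply/setP => x; rewrite inE ffunE; case: ifP. Qed.

Lemma uniform_bc_valid T l b : layered T -> boundary_condition (uniform_bc T l b).
Proof.
move=> hT; have /independentP h := sphere_independent l hT.
apply/independentP => x y; rewrite !inE !ffunE.
by case: ifP => // xs _; case: ifP => // ys _; exact: h.
Qed.

Lemma ratio_uniform_bc T k b : layered T ->
  ratio (uniform_bc T k.+1 b) (root T) lam = sphere_ratio T k b.
Proof. by move=> hT; rewrite ratio_two_state // ffunE root_sphere. Qed.

Lemma bc_weight_ge0 T (s : T -> option bool) x c : 0 <= bc_weight lam s x c.
Proof.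
by rewrite /bc_weight; case: (s x) => [d|]; [exact: ler0n|case: c => //; exact: ltW].
Qed.

Lemma bc_state_ge0 T l b c : 0 <= bc_state T l b c.
Proof. by apply: sumr_ge0 => J _; apply: prodr_ge0 => x _; exact: bc_weight_ge0. Qed.

(** The contribution of the configuration in which every free vertex is out is
    already positive. *)
Lemma bc_state_gt0 T l b : layered T -> 0 < bc_state T l b (b && (l == 0)%N).
Proof.
move=> hT; pose J0 := if b then sphere (root T) l else set0.
rewrite /bc_state /two_state (bigD1 J0) /=; last first.
  rewrite /J0; case: (b); last first.
    by rewrite inE eqxx andbT; apply/independentP => x y; rewrite inE.
  by rewrite sphere_independent // root_sphere // eqxx.
rewrite big1 => [|x _]; last first.
  rewrite /bc_weight ffunE /J0; case: ifP => xs; case: (b) => //=; rewrite ?xs ?inE //.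
apply: ltr_wpDr => //; apply: sumr_ge0 => J _; apply: prodr_ge0 => x _.
exact: bc_weight_ge0.
Qed.

Lemma bc_state_total_gt0 T l b : layered T ->
  0 < bc_state T l b true + bc_state T l b false.
Proof.
move=> hT; have := bc_state_gt0 l b hT; have := bc_state_ge0 T l b.
by move=> h; case: (b && _) => h0; [have := h false | have := h true]; lra.
Qed.

Lemma bc_state_root T b : layered T -> bc_state T 0 b (~~ b) = 0.
Proof.
move=> hT; apply: big1 => J /andP[_ /eqP hJ].
rewrite (bigD1 (root T)) //= /bc_weight ffunE root_sphere //= hJ.
by case: (b); rewrite mul0r.
Qed.

Lemma out_prob0 T b : layered T -> out_prob T 0 b = (~~ b)%:R.
Proof.
move=> hT; have := bc_state_root b hT; have := bc_state_total_gt0 0 b hT.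
rewrite /out_prob; case: b => /= h e; rewrite e; first by rewrite mul0r.
by move: h; rewrite e add0r => h; rewrite divff // gt_eqF.
Qed.

Lemma out_probS T k b : layered T ->
  out_prob T k.+1 b = (1 + sphere_ratio T k b)^-1.
Proof.
move=> hT; rewrite /out_prob /sphere_ratio.
have := bc_state_gt0 k.+1 b hT; have := bc_state_total_gt0 k.+1 b hT.
rewrite andbF; move: (bc_state _ _ _ true) (bc_state _ _ _ false) => u w h1 h2.
by field; rewrite !gt_eqF //=; lra.
Qed.

(** The new branch hangs one level below the root, so its own sphere is one step
    closer. *)
Lemma bc_state_attach T B k b c : layered T -> layered B ->
  bc_state (attach T B) k.+1 b c =
  bc_state T k.+1 b c * ((if c then 0 else bc_state B k b true) + bc_state B k b false).
Proof.
move=> hT hB; rewrite {1}/bc_state two_state_attach -mulrDr.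
have e1 d : two_state (fun a : T => bc_weight lam (uniform_bc (attach T B) k.+1 b) (inl a)) d
    = bc_state T k.+1 b d.
  by apply: eq_two_state => x e; rewrite /bc_weight !ffunE sphere_attach_inl.
have e2 d : two_state (fun a : B => bc_weight lam (uniform_bc (attach T B) k.+1 b) (inr a)) d
    = bc_state B k b d.
  by apply: eq_two_state => x e; rewrite /bc_weight !ffunE sphere_attach_inr.
by rewrite e1 !e2.
Qed.

Lemma sphere_ratio_attach T B k b : layered T -> layered B ->
  sphere_ratio (attach T B) k b = sphere_ratio T k b * out_prob B k b.
Proof.
move=> hT hB; rewrite /sphere_ratio !bc_state_attach // add0r /out_prob.
by rewrite invfM mulrACA.
Qed.

Lemma sphere_ratio_point k b : sphere_ratio point k b = lam.
Proof.
have hW c : bc_state point k.+1 b c = if c then lam else 1.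
  rewrite /bc_state /two_state (big_pred1 [set x | c]) => [|J].
    rewrite (big_pred1 tt) => [|[]//]; rewrite inE /bc_weight ffunE.
    by have := root_sphere k.+1 layered_point => /= ->.
  have -> : independent J by apply/independentP.
  apply/eqP/eqP => [h|->]; last by rewrite inE.
  by apply/setP => -[]; rewrite inE -h.
by rewrite /sphere_ratio !hW divr1.
Qed.

Lemma sphere_ratio_join_root (X : Type) (t : X -> rgraph) (s : seq X) k b :
  (forall x, layered (t x)) ->
  sphere_ratio (join_root [seq t x | x <- s]) k b =
  lam * \prod_(x <- s) out_prob (t x) k b.
Proof.
move=> ht; elim: s => [|x s IH]; first by rewrite big_nil mulr1 sphere_ratio_point.
rewrite big_cons /= sphere_ratio_attach //; last exact: layered_join_root.
by rewrite IH -mulrA [X in lam * X]mulrC.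
Qed.

(** Fixing the sphere in lowers the ratios of the parents and raises those of the
    grandparents: the parity of the depth decides which extreme is reached. *)
Lemma sphere_ratio_saw_tree (G : sgraph) (le : rel G) (x : {set G} * G) k b :
  x.2 \in x.1 ->
  sphere_ratio (saw_tree le x.1 x.2) k b =
  extreme_ratio (saw_children le) lam k (~~ b (+) odd k) x.
Proof.
elim: k x => [|k IH] x xx; rewrite saw_treeE // branchesE sphere_ratio_join_root;
  try (by move=> c; exact: layered_saw_tree).
  rewrite addbF /=; congr (_ * _); apply: eq_bigr => c _.
  by rewrite out_prob0 //; exact: layered_saw_tree.
congr (_ * _); apply: eq_big_seq => c /saw_childrenP[_ cc].
rewrite out_probS; last exact: layered_saw_tree.
by rewrite IH //= addbN negbK.
Qed.

End UniformBoundary.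

(** * From mixing to the absence of zeros *)

Lemma induced_poly_gt0 (G : sgraph) (R : realFieldType) (lam : R) (A : {set G}) :
  0 < lam -> 0 < induced_poly (fun=> lam) A.
Proof.
move=> l0; rewrite /induced_poly (bigD1 set0) /=; last first.
  by rewrite sub0set; apply/independentP => x y; rewrite inE.
rewrite big_set0; apply: ltr_wpDr => //; apply: sumr_ge0 => I _.
by apply: prodr_ge0 => v _; exact: ltW.
Qed.

Lemma saw_children_setU1 (G : sgraph) (le : rel G) (A : {set G}) v :
  v \notin A -> saw_children le (v |: A, v) = saw_children le (A, v).
Proof.
move=> vA; rewrite /saw_children /= setU1K //.
have -> : A :\ v = A.
  by apply/setP => x; rewrite !inE; case: eqP => // ->; rewrite (negPf vA).
rewrite /sorted_neighbours; have -> // : neighbours v :&: (v |: A) = neighbours v :&: A.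
by apply/setP => x; rewrite !inE; case: eqP => //= ->; rewrite adj_irr.
Qed.

(** The two extremes come from the all-in and all-out conditions on the sphere
    of radius [k + 1]. For [v] outside [A] the children of [(A, v)] are those of
    [(v |: A, v)], which lets the bound hold without restriction on the state. *)
Lemma extreme_ratio_gap_of_VSSM (R : realType) (le : forall G : sgraph, rel G)
    (F : sgraph -> Prop) (lam : R) : 0 < lam -> VSSM le F lam ->
  exists alpha C : R, [/\ 0 <= alpha, alpha < 1, 0 < C &
    forall (G : sgraph), F G -> forall k (x : {set G} * G),
    extreme_ratio (saw_children (le G)) lam k true x
      - extreme_ratio (saw_children (le G)) lam k false x <= C * alpha ^+ k.+1].
Proof.
move=> l0 [alpha [C [a0 a1 C0 h]]]; exists alpha, C; split=> // G FG k.
suff main (x : {set G} * G) : x.2 \in x.1 ->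
    extreme_ratio (saw_children (le G)) lam k true x
      - extreme_ratio (saw_children (le G)) lam k false x <= C * alpha ^+ k.+1.
  case=> A v; have [vA|vA] := boolP (v \in A); first exact: main.
  have e b : extreme_ratio (saw_children (le G)) lam k b (A, v)
      = extreme_ratio (saw_children (le G)) lam k b (v |: A, v).
    by case: k {main} => [|k]; rewrite /= saw_children_setU1.
  by rewrite !e; apply: main; exact: setU11.
move=> xx; have hT := layered_saw_tree (le G) x.1 x.2.
have := h G FG x.1 x.2 xx k.+1 isT
  (uniform_bc (saw_tree (le G) x.1 x.2) k.+1 (odd k))
  (uniform_bc (saw_tree (le G) x.1 x.2) k.+1 (~~ odd k))
  (uniform_bc_valid _ _ hT) (uniform_bc_valid _ _ hT)
  (uniform_bc_dom _ _ _) (uniform_bc_dom _ _ _).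
rewrite !ratio_uniform_bc // !sphere_ratio_saw_tree // negbK addbb.
rewrite addNb addbb; exact: le_trans (ler_norm _).
Qed.

Section Stability.
Variables (R : rcfType) (G : sgraph) (le : rel G) (lstar : R).
Variables (d eps : R) (lam : G -> R[i]).
Local Notation N := (@ComplexField.Normc.normc R).
Hypothesis lstar_gt0 : 0 < lstar.
Hypothesis lam_near : forall v, N (lam v - lstar%:C%C) <= eps * lstar.

Local Notation r := (vertex_ratio (fun _ : G => lstar)).

Definition relative_error (x : {set G} * G) : R[i] :=
  vertex_ratio lam x / (r x)%:C%C - 1.
Local Notation e := relative_error.

Lemma real_vertex_ratio_gt0 x : 0 < r x.
Proof. by rewrite /vertex_ratio divr_gt0 ?mulr_gt0 ?induced_poly_gt0. Qed.

Lemma real_vertex_ratio_rec x : r x = lstar * \prod_(c <- saw_children le x) (1 + r c)^-1.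
Proof. by apply: vertex_ratio_rec => B _; rewrite gt_eqF ?induced_poly_gt0. Qed.

Lemma realC_neq0 (a : R) : 0 < a -> (a%:C)%C != 0 :> R[i].
Proof. by move=> a0; rewrite -(rmorph0 (real_complex R)) (inj_eq (@complexI R)) gt_eqF. Qed.

Lemma one_plus_vertex_ratio x :
  1 + vertex_ratio lam x = (1 + r x)%:C%C * (1 + (occupation r x)%:C%C * e x).
Proof.
have r0 := real_vertex_ratio_gt0 x; have r1 : 0 < 1 + r x by lra.
have c0 := realC_neq0 r0; have c1 := realC_neq0 r1.
rewrite /occupation fmorph_div rmorphD rmorph1 in c1 *; rewrite /relative_error.
by field; rewrite c0 c1.
Qed.

Lemma error_rec x :
  (forall B : {set G}, B \subset x.1 :\ x.2 -> induced_poly lam B != 0) ->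
  exists2 eta, N eta <= eps &
    1 + e x = (1 + eta)
              * \prod_(c <- saw_children le x) (1 + (occupation r c)%:C%C * e c)^-1.
Proof.
move=> nz; have c0 := realC_neq0 lstar_gt0.
exists (lam x.2 / lstar%:C%C - 1).
  have -> : lam x.2 / lstar%:C%C - 1 = (lam x.2 - lstar%:C%C) / lstar%:C%C.
    by rewrite mulrBl divff.
  rewrite nrmM nrmV nrmR gtr0_norm // ler_pdivrMr //; exact: lam_near.
pose p : R := \prod_(c <- saw_children le x) (1 + r c)^-1.
have p0 : 0 < p.
  by apply: prodr_gt0 => c _; rewrite invr_gt0 addr_gt0 ?real_vertex_ratio_gt0.
have hr : (r x)%:C%C = lstar%:C%C * p%:C%C :> R[i] by rewrite real_vertex_ratio_rec rmorphM.
have hrho : \prod_(c <- saw_children le x) (1 + vertex_ratio lam c)^-1 =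
    p%:C%C * \prod_(c <- saw_children le x) (1 + (occupation r c)%:C%C * e c)^-1.
  rewrite rmorph_prod -big_split /=; apply: eq_bigr => c _.
  by rewrite one_plus_vertex_ratio invfM fmorphV.
have hE : 1 + e x = vertex_ratio lam x / (r x)%:C%C by rewrite /relative_error addrC subrK.
rewrite hE hr (@vertex_ratio_rec G le _ lam x nz) hrho addrCA subrr addr0.
by field; rewrite c0 realC_neq0.
Qed.

Hypothesis d_lt1 : d < 1.
(** The conclusion of [relative_error_contraction] for the tree of self avoiding
    walks of [G]. *)
Hypothesis contraction : forall n,
  (forall x, (#|x.1 :\ x.2| <= n)%N -> exists2 eta, N eta <= eps &
     1 + e x = (1 + eta)
               * \prod_(c <- saw_children le x) (1 + (occupation r c)%:C%C * e c)^-1) ->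
  (forall x, (#|x.1 :\ x.2| < n)%N -> N (e x) <= d) ->
  forall x, (#|x.1 :\ x.2| <= n)%N -> N (e x) <= d.

(** [1 + rho = (1 + r) * (1 + p * e)] with [|p * e| <= d < 1]. *)
Lemma one_plus_vertex_ratio_neq0 x : N (e x) <= d -> 1 + vertex_ratio lam x != 0.
Proof.
move=> hd; have r0 := real_vertex_ratio_gt0 x.
rewrite one_plus_vertex_ratio mulf_neq0 ?realC_neq0 ?addr_gt0 //.
have o0 := occupation_ge0 real_vertex_ratio_gt0 x.
have o1 := occupation_le1 real_vertex_ratio_gt0 x.
have hz : N ((occupation r x)%:C%C * e x) <= d.
  rewrite nrmM nrmR ger0_norm //; apply: le_trans hd.
  by rewrite ler_piMl // nrm_ge0.
apply/eqP => h; have := nrm_1D ((occupation r x)%:C%C * e x).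
by rewrite h nrm0 subr_le0 leNgt (le_lt_trans hz).
Qed.

(** Nonvanishing and smallness of the errors are proved together, by induction on
    the number of vertices: the recursion for the errors divides by the polynomials
    of smaller vertex sets, and a small error at a vertex of [A] lifts nonvanishing from [A - v] to [A]. *)
Lemma induced_poly_neq0 (B : {set G}) : induced_poly lam B != 0.
Proof.
have main n : (forall x, (#|x.1 :\ x.2| < n)%N -> N (e x) <= d) /\
    (forall A : {set G}, (#|A| <= n)%N -> induced_poly lam A != 0).
  elim: n => [|n [IHe IHZ]].
    split=> // A; rewrite leqn0 cards_eq0 => /eqP ->.
    rewrite /induced_poly (big_pred1 set0) ?big_set0 ?oner_eq0 // => I.
    rewrite subset0 /=; have [->|//] := eqVneq I set0.
    by apply/independentP => x y; rewrite inE.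
  have he x : (#|x.1 :\ x.2| <= n)%N -> N (e x) <= d.
    apply: contraction => // y yn; apply: error_rec => A sA; apply: IHZ.
    exact: leq_trans (subset_leq_card sA) yn.
  split=> // A; rewrite leq_eqVlt ltnS => /orP[/eqP cA|]; last exact: IHZ.
  have /card_gt0P[v vA] : (0 < #|A|)%N by rewrite cA.
  have cv : (#|A :\ v| <= n)%N by move: cA; rewrite (cardsD1 v) vA add1n => -[->].
  have := one_plus_vertex_ratio_neq0 (he (A, v) cv).
  rewrite one_plus_vertex_ratioE //; last exact: IHZ.
  by rewrite mulf_eq0 negb_or => /andP[].
by have [_] := main #|B|; exact.
Qed.

End Stability.

Theorem theorem8 (R : realType) (Delta : nat) (hDelta : (0 < Delta)%N)
  (lstar : R) (hlstar : 0 < lstar)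
  (F : sgraph -> Prop)
  (hdeg : forall G : sgraph, F G -> (max_degree G <= Delta)%N)
  (le : forall G : sgraph, rel G)
  (hle : forall G : sgraph, F G -> total_order (le G))
  (hVSSM : VSSM le F lstar) :
  exists eps : R, 0 < eps /\
    forall G : sgraph, F G ->
    forall lam : G -> R[i],
      (forall v : G, disc (lstar%:C)%C eps (lam v)) ->
      indep_poly lam <> 0.
Proof.
have [alpha [C [a0 a1 C0 hgap]]] := extreme_ratio_gap_of_VSSM hlstar hVSSM.
have [l hl] := influence_decay hlstar hDelta C0 a0 a1.
have [d [eps [d0 d1 eps0 hcontr]]] := relative_error_contraction R Delta l.
exists (eps * lstar); split; first exact: mulr_gt0.
move=> G FG lam hlam; apply/eqP; rewrite -induced_poly_setT.
have hsize x : (size (saw_children (le G) x) <= Delta)%N.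
  exact: leq_trans (saw_children_size _ _) (hdeg G FG).
have hinf := hl _ (saw_children (le G)) (vertex_ratio (fun=> lstar)) hsize
  (real_vertex_ratio_gt0 hlstar) (real_vertex_ratio_rec (le G) hlstar) (hgap G FG).
have hlam' v : ComplexField.Normc.normc (lam v - lstar%:C%C) <= eps * lstar.
  by have := hlam v; rewrite /disc nrm_def ltcR => /ltW.
have stable n := @hcontr _ (saw_children (le G)) (vertex_ratio (fun=> lstar))
  (relative_error lstar lam) (fun x => #|x.1 :\ x.2|) n hsize
  (real_vertex_ratio_gt0 hlstar) hinf (fun x c => @saw_children_card G (le G) x c).
exact: induced_poly_neq0 hlstar hlam' d1 stable _.
Qed.
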